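(* Let $m\ge0$ be an integer and $x>0$. Then, with the same choice of sign on both sides, $$\left.\frac{\partial \mathrm{W}_{\kappa,\mu}(x)}{\partial\mu}\right|_{\kappa=(1+m)/2,\ \mu=\pm m/2}=\pm e^{-x/2}x^{(1+m)/2}\sum_{k=1}^{m}x^{-k}\left[e^{x}\,\Gamma(k)+\binom{m}{k}\,\gamma(k,-x)\right].$$
   Context: For $x>0$, the Whittaker function is $\mathrm{W}_{\kappa,\mu}(x)=e^{-x/2}x^{\mu+1/2}\,\mathrm{U}\left(\frac12+\mu-\kappa,1+2\mu,x\right)$, where $\mathrm{U}$ is the Tricomi confluent hypergeometric function. $\gamma(\nu,z)=\int_0^z t^{\nu-1}e^{-t}\,dt$ is the lower incomplete gamma function. *)

(* Defs.v *)
From Stdlib Require Import Reals ClassicalEpsilon.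
From Coquelicot Require Import Coquelicot.

Open Scope R_scope.

(* Kummer's equation  x f'' + (b - x) f' - a f = 0  on the half-line x > 0.
   Both [ex_derive] clauses are needed: [Derive] is total, so
   [ex_derive (Derive f) x] does not imply that f is differentiable. *)
Definition kummer_solution (a b : R) (f : R -> R) : Prop :=
  forall x : R, 0 < x ->
    ex_derive f x /\ ex_derive (Derive f) x /\
    x * Derive_n f 2 x + (b - x) * Derive f x - a * f x = 0.

(* The solution with f(x) ~ x^(-a) as x -> +oo.  Solutions not proportional to it grow like
   e^x x^(a-b), so this determines f on (0, +oo), for all real a and b,
   including those where the Laplace integral diverges or the formula in terms
   of 1F1 is singular. *)
Definition is_tricomi_U (a b : R) (f : R -> R) : Prop :=
  kummer_solution a b f /\ is_lim (fun x => Rpower x a * f x) p_infty 1.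

(* Meaningful for positive argument only. *)
Definition tricomi_U (a b : R) : R -> R :=
  epsilon (inhabits (fun _ : R => 0)) (is_tricomi_U a b).

Definition whittaker_W (kappa mu x : R) : R :=
  exp (- x / 2) * Rpower x (mu + 1 / 2)
  * tricomi_U (1 / 2 + mu - kappa) (1 + 2 * mu) x.

Definition Gamma (s : R) : R :=
  RInt_gen (fun t => Rpower t (s - 1) * exp (- t))
           (at_right 0) (Rbar_locally p_infty).

(* gamma(k, z) for an integer order k >= 1: the natural power t^(k-1) makes the
   integrand real on the whole line, so that z may be negative, in which case
   the integral is the oriented one. *)
Definition lower_gamma (k : nat) (z : R) : R :=
  RInt (fun t => t ^ (k - 1) * exp (- t)) 0 z.

(* Main.v *)
(* Write U(a, 1 + m + 2a, x) = x^(-a) w(1/x). Kummer's equation becomes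
   (E w')' = c (E / y^2) w with E(y) = y^(1-m) e^(-1/y) and c = a (m + a), and
   the normalisation at infinity becomes w(0) = 1. For kappa = (1 + m)/2 one has
   a = mu - m/2, so c = mu^2 - m^2/4 and
   W_{kappa,mu}(x) = e^(-x/2) x^((1+m)/2) w_c(1/x) depends on mu only through
   mu^2; its mu-derivative at +-m/2 is +-m times the c-derivative of w_c at 0.

   The equation amounts to w(y) = 1 + c int_0^y L w, where
   L f(y) = E(y)^(-1) int_0^y E(s) s^(-2) f(s) ds is continuous up to y = 0 and
   locally bounded. Hence w_c is an entire series in c, whose first coefficient
   is int_0^y L 1 with m L 1 a polynomial, and a binomial identity rewrites that
   polynomial in terms of incomplete gamma functions.

   Two solutions normalised at infinity agree: their Wronskian is
   C x^(-b) e^x, which makes their quotient unbounded unless C = 0. *)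
Require Import Defs.
From Stdlib Require Import Reals Factorial ClassicalEpsilon Lra Lia.
From Coquelicot Require Import Coquelicot.

Open Scope R_scope.

(** * The weight of the averaging operator *)

(* [E / y^2], extended by 0 to the left of 0. *)
Definition weight (m : nat) (s : R) : R :=
  if Rle_dec s 0 then 0 else exp (- / s) / s ^ S m.

Lemma weight_nonpos (m : nat) (s : R) : s <= 0 -> weight m s = 0.
Proof. intros Hs; unfold weight; destruct (Rle_dec s 0); lra. Qed.

Lemma weight_pos_eq (m : nat) (s : R) :
  0 < s -> weight m s = exp (- / s) / s ^ S m.
Proof. intros Hs; unfold weight; destruct (Rle_dec s 0); lra. Qed.

Lemma weight_gt0 (m : nat) (s : R) : 0 < s -> 0 < weight m s.
Proof.
intros Hs; rewrite weight_pos_eq by easy.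
apply Rdiv_lt_0_compat; [apply exp_pos | now apply pow_lt].
Qed.

Lemma weight_ge0 (m : nat) (s : R) : 0 <= weight m s.
Proof.
destruct (Rle_dec s 0) as [Hs|Hs].
- rewrite weight_nonpos; lra.
- apply Rlt_le, weight_gt0; lra.
Qed.

(** For [0 <= t] the Taylor terms of [exp] are nonnegative, so one of them lies below the partial
    sum. This is the growth estimate used both near 0 and at infinity. *)
Lemma pow_div_fact_le_exp (n : nat) (t : R) :
  0 <= t -> t ^ n / INR (fact n) <= exp t.
Proof.
intros Ht.
apply Rle_trans with (2 := exp_ge_taylor t n Ht).
destruct n as [|n]; [simpl; lra|].
rewrite tech5.
assert (0 <= sum_f_R0 (fun k : nat => t ^ k / INR (fact k)) n); [|lra].
apply cond_pos_sum; intros k.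
apply Rdiv_le_0_compat; [now apply pow_le | apply INR_fact_lt_0].
Qed.

(** The Taylor term of order [m + 2] at [/ s] leaves exactly one factor [s] after the division by
    [s ^ S m]. Hence the weight tends to 0 at 0. *)
Lemma weight_bound (m : nat) (s : R) :
  weight m s <= INR (fact (m + 2)) * Rabs s.
Proof.
destruct (Rle_dec s 0) as [Hs|Hs].
- rewrite weight_nonpos by easy.
  apply Rmult_le_pos; [apply pos_INR | apply Rabs_pos].
- assert (Hs' : 0 < s) by lra.
  rewrite weight_pos_eq, Rabs_pos_eq by lra.
  assert (H := pow_div_fact_le_exp (m + 2) (/ s)
                 (Rlt_le _ _ (Rinv_0_lt_compat _ Hs'))).
  assert (HF := INR_fact_lt_0 (m + 2)).
  rewrite exp_Ropp.
  assert (Hp : 0 < s ^ S m) by now apply pow_lt.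
  assert (He := exp_pos (/ s)).
  replace (INR (fact (m + 2)) * s)
    with (/ ((/ s) ^ (m + 2) / INR (fact (m + 2))) / s ^ S m).
  + apply Rmult_le_compat_r; [now apply Rlt_le, Rinv_0_lt_compat|].
    apply Rinv_le_contravar; [|exact H].
    apply Rdiv_lt_0_compat; [|easy].
    now apply pow_lt, Rinv_0_lt_compat.
  + rewrite pow_inv. replace (m + 2)%nat with (S (S m)) at 1 by lia.
    rewrite <- !tech_pow_Rmult in *. field.
    assert (0 < s ^ m) by now apply pow_lt. repeat split; lra.
Qed.

Lemma is_derive_weight (m : nat) (s : R) :
  0 < s ->
  is_derive (weight m) s (weight m s * (/ s ^ 2 - INR (S m) / s)).
Proof.
intros Hs.
apply is_derive_ext_loc with (fun s => exp (- / s) / s ^ S m).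
- exists (mkposreal s Hs); intros t Ht.
  symmetry; apply weight_pos_eq.
  apply Rabs_def2 in Ht; unfold minus, plus, opp in Ht; simpl in Ht; lra.
- rewrite weight_pos_eq by easy.
  assert (Hm : s ^ S m <> 0) by (apply pow_nonzero; lra).
  auto_derive.
  + repeat split; simpl in *; lra.
  + change (pred (S m)) with m. rewrite <- (tech_pow_Rmult s m) in *.
    assert (s ^ m <> 0) by (apply pow_nonzero; lra).
    change (match m with 0%nat => 1 | S _ => INR m + 1 end) with (INR (S m)).
    field. split; lra.
Qed.

Lemma continuous_weight (m : nat) (s : R) : continuous (weight m) s.
Proof.
destruct (Rtotal_order s 0) as [Hs|[Hs|Hs]].
- apply continuous_ext_loc with (fun _ => 0).
  + assert (Hp : 0 < - s) by lra.
    exists (mkposreal _ Hp); intros t Ht.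
    symmetry; apply weight_nonpos.
    apply Rabs_def2 in Ht; unfold minus, plus, opp in Ht; simpl in Ht; lra.
  + apply continuous_const.
- subst s. unfold continuous. rewrite (weight_nonpos m 0) by lra.
  apply filterlim_locally; intros eps.
  set (F := INR (fact (m + 2))).
  assert (HF : 0 < F) by apply INR_fact_lt_0.
  assert (Hd : 0 < eps / F) by (apply Rdiv_lt_0_compat; [apply eps | easy]).
  exists (mkposreal _ Hd); intros t Ht.
  assert (Ht' : Rabs t < eps / F).
  { revert Ht; unfold ball; simpl; unfold AbsRing_ball, abs, minus, plus, opp; simpl.
    now rewrite Ropp_0, Rplus_0_r. }
  unfold ball; simpl; unfold AbsRing_ball, abs, minus, plus, opp; simpl.
  rewrite Ropp_0, Rplus_0_r, Rabs_pos_eq by apply weight_ge0.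
  apply Rle_lt_trans with (1 := weight_bound m t). fold F.
  replace (pos eps) with (F * (eps / F)) by (field; lra).
  now apply Rmult_lt_compat_l.
- apply (ex_derive_continuous (V := R_NormedModule)). eexists. now apply is_derive_weight.
Qed.

(** The function is the weight [E(s) = s^(1-m) e^(-1/s)] of the self-adjoint equation, extended by
    0. It is differentiable at 0 as well, which lets integrals start at 0. *)
Lemma is_derive_sq_weight (m : nat) (s : R) :
  is_derive (fun s => s ^ 2 * weight m s) s
    (weight m s * (1 + (1 - INR m) * s)).
Proof.
destruct (Rtotal_order s 0) as [Hs|[Hs|Hs]].
- apply is_derive_ext_loc with (fun _ => 0).
  + assert (Hp : 0 < - s) by lra.
    exists (mkposreal _ Hp); intros t Ht.
    change (0 = t ^ 2 * weight m t); rewrite weight_nonpos; [ring|].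
    apply Rabs_def2 in Ht; unfold minus, plus, opp in Ht; simpl in Ht; lra.
  + rewrite weight_nonpos by lra. rewrite Rmult_0_l. apply (is_derive_const (V := R_NormedModule)).
- subst s. rewrite (weight_nonpos m 0) by lra. rewrite Rmult_0_l.
  apply is_derive_Reals; intros eps Heps.
  assert (Hc := continuous_weight m 0).
  unfold continuous in Hc. rewrite (weight_nonpos m 0) in Hc by lra.
  destruct (proj1 (filterlim_locally _ _) Hc (mkposreal 1 Rlt_0_1)) as [d Hd].
  assert (Hd' : 0 < Rmin d eps) by (apply Rmin_pos; [apply d | easy]).
  exists (mkposreal _ Hd'); intros h Hh0 Hh; simpl in Hh.
  assert (Hh1 := Rlt_le_trans _ _ _ Hh (Rmin_l _ _)).
  assert (Hh2 := Rlt_le_trans _ _ _ Hh (Rmin_r _ _)).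
  rewrite (weight_nonpos m 0) by lra. rewrite Rplus_0_l.
  replace ((h ^ 2 * weight m h - 0 ^ 2 * 0) / h - 0) with (h * weight m h)
    by (field; easy).
  assert (Hb : Rabs (weight m h) < 1).
  { specialize (Hd h). revert Hd.
    unfold ball; simpl; unfold AbsRing_ball, abs, minus, plus, opp; simpl.
    rewrite Ropp_0, !Rplus_0_r. auto. }
  rewrite Rabs_mult.
  assert (0 <= Rabs h) by apply Rabs_pos.
  assert (0 <= Rabs (weight m h)) by apply Rabs_pos. nra.
- evar_last.
  + apply (is_derive_mult (fun s => s ^ 2) (weight m) s (2 * s)).
    * auto_derive; [easy|ring].
    * now apply is_derive_weight.
    * intros; apply Rmult_comm.
  + rewrite S_INR. unfold plus, mult; simpl. field. lra.
Qed.

(** * The averaging operator *)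

(* The operator [L], extended continuously to the left of 0. *)
Definition avg (m : nat) (f : R -> R) (y : R) : R :=
  if Rle_dec y 0 then f 0
  else RInt (fun s => weight m s * f s) 0 y / (y ^ 2 * weight m y).

Lemma avg_nonpos (m : nat) (f : R -> R) (y : R) : y <= 0 -> avg m f y = f 0.
Proof. intros Hy; unfold avg; destruct (Rle_dec y 0); lra. Qed.

Lemma avg_pos (m : nat) (f : R -> R) (y : R) :
  0 < y ->
  avg m f y = RInt (fun s => weight m s * f s) 0 y / (y ^ 2 * weight m y).
Proof. intros Hy; unfold avg; destruct (Rle_dec y 0); lra. Qed.

Lemma sq_weight_gt0 (m : nat) (y : R) : 0 < y -> 0 < y ^ 2 * weight m y.
Proof.
intros Hy; apply Rmult_lt_0_compat; [now apply pow_lt | now apply weight_gt0].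
Qed.

Lemma continuous_weight_mult (m : nat) (f : R -> R) (s : R) :
  continuous f s -> continuous (fun s => weight m s * f s) s.
Proof.
intros Hf; apply (continuous_mult (weight m) f); [apply continuous_weight | easy].
Qed.

Lemma ex_RInt_cont (f : R -> R) (a b : R) :
  (forall s, continuous f s) -> ex_RInt f a b.
Proof.
intros Hf; apply (ex_RInt_continuous (V := R_CompleteNormedModule)); auto.
Qed.

Lemma ex_RInt_weight (m : nat) (f : R -> R) (a b : R) :
  (forall s, continuous f s) -> ex_RInt (fun s => weight m s * f s) a b.
Proof.
intros Hf; apply ex_RInt_cont; intros s; now apply continuous_weight_mult.
Qed.

Lemma is_derive_RInt_cont (f : R -> R) (a y : R) :
  (forall s, continuous f s) -> is_derive (RInt f a) y (f y).
Proof.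
intros Hf; apply (is_derive_RInt (V := R_NormedModule)) with a; [|apply Hf].
apply filter_forall; intros b; apply (RInt_correct (V := R_CompleteNormedModule)).
now apply ex_RInt_cont.
Qed.

Lemma continuous_affine (a b s : R) : continuous (fun s => a + b * s) s.
Proof.
apply (ex_derive_continuous (V := R_NormedModule)); auto_derive; easy.
Qed.

(** This writes the denominator of [avg] as an integral against the same weight, so that estimates
    of the quotient reduce to pointwise comparisons of integrands. *)
Lemma RInt_weight_affine (m : nat) (y : R) :
  RInt (fun s => weight m s * (1 + (1 - INR m) * s)) 0 y = y ^ 2 * weight m y.
Proof.
apply (is_RInt_unique (V := R_CompleteNormedModule)).
evar_last.
- apply (is_RInt_derive (V := R_CompleteNormedModule) (fun s => s ^ 2 * weight m s)).
  + intros s _; apply is_derive_sq_weight.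
  + intros s _; apply continuous_weight_mult, continuous_affine.
- unfold minus, plus, opp; simpl; ring.
Qed.

Lemma continuous_at_iff (f : R -> R) (s : R) :
  continuous f s <->
  (forall eps, 0 < eps -> exists d, 0 < d /\
     forall t, Rabs (t - s) < d -> Rabs (f t - f s) < eps).
Proof.
split.
- intros Hf eps Heps.
  destruct (proj1 (filterlim_locally _ _) Hf (mkposreal eps Heps)) as [d Hd].
  exists d; split; [apply d|]; intros t Ht; exact (Hd t Ht).
- intros Hf; apply filterlim_locally; intros eps.
  destruct (Hf eps (cond_pos eps)) as [d [Hd H]].
  exists (mkposreal d Hd); intros t Ht; exact (H t Ht).
Qed.

(* L'Hopital: the derivative of [y ^ 2 * weight m y] is
   [weight m y * (1 + (1 - m) y)], so [avg m f y] has the limit [f 0]. *)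
Lemma continuous_avg_0 (m : nat) (f : R -> R) :
  (forall s, continuous f s) -> continuous (avg m f) 0.
Proof.
intros Hf; apply continuous_at_iff; intros eps Heps.
rewrite (avg_nonpos m f 0) by lra.
(* The denominator is the weighted integral of [k], so the deviation of [avg m f y] from [f 0] is
   the weighted integral of [g], divided by it. Near 0, [Rabs (g s) < eps / 4] and [k s > 1 / 2],
   hence [Rabs (g s) <= eps / 2 * k s]. *)
set (k := fun s => 1 + (1 - INR m) * s).
set (g := fun s => f s - f 0 * k s).
assert (Hk : forall s, continuous k s) by (intros; apply continuous_affine).
assert (Hg : forall s, continuous g s).
{ intros s; apply (continuous_minus (V := R_NormedModule) f); [apply Hf|].
  apply (continuous_mult (fun _ => f 0) k); [apply continuous_const | apply Hk]. }
assert (Hg0 : g 0 = 0) by (unfold g, k; ring).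
assert (Hk0 : k 0 = 1) by (unfold k; ring).
destruct (proj1 (continuous_at_iff _ _) (Hg 0) (eps / 4)) as [d1 [Hd1 H1]]; [lra|].
destruct (proj1 (continuous_at_iff _ _) (Hk 0) (1 / 2)) as [d2 [Hd2 H2]]; [lra|].
exists (Rmin d1 d2); split; [now apply Rmin_pos|].
intros y Hy; rewrite Rminus_0_r in Hy.
destruct (Rle_dec y 0) as [Hy0|Hy0].
{ rewrite avg_nonpos, Rminus_diag, Rabs_R0 by easy; easy. }
assert (Hy' : 0 < y) by lra.
rewrite Rabs_pos_eq in Hy by lra.
assert (HE := sq_weight_gt0 m y Hy').
assert (HN : RInt (fun s => weight m s * g s) 0 y
  = RInt (fun s => weight m s * f s) 0 y - f 0 * (y ^ 2 * weight m y)).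
{ rewrite <- RInt_weight_affine.
  rewrite <- (RInt_scal (V := R_CompleteNormedModule)) by now apply ex_RInt_weight.
  rewrite <- (RInt_minus (V := R_CompleteNormedModule)).
  - apply RInt_ext; intros s _; unfold g, k, minus, plus, opp, scal; simpl.
    unfold mult; simpl; ring.
  - now apply ex_RInt_weight.
  - apply (ex_RInt_scal (V := R_NormedModule)); now apply ex_RInt_weight. }
assert (HB : Rabs (RInt (fun s => weight m s * g s) 0 y)
             <= eps / 2 * (y ^ 2 * weight m y)).
{ apply Rle_trans with (1 := abs_RInt_le _ _ _ (Rlt_le _ _ Hy') (ex_RInt_weight m g 0 y Hg)).
  rewrite <- RInt_weight_affine, <- (RInt_scal (V := R_CompleteNormedModule))
    by now apply ex_RInt_weight.
  apply RInt_le.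
  - lra.
  - apply ex_RInt_cont; intros s.
    apply (continuous_comp (fun s => weight m s * g s) Rabs).
    + now apply continuous_weight_mult.
    + apply continuous_Rabs.
  - apply (ex_RInt_scal (V := R_NormedModule)); now apply ex_RInt_weight.
  - intros s Hs. assert (Hm1 := Rmin_l d1 d2). assert (Hm2 := Rmin_r d1 d2).
    specialize (H1 s); specialize (H2 s).
    rewrite Rminus_0_r, Hg0, Rminus_0_r in H1.
    rewrite Rminus_0_r, Hk0 in H2.
    rewrite Rabs_pos_eq in H1, H2 by lra.
    specialize (H1 ltac:(lra)); specialize (H2 ltac:(lra)).
    apply Rabs_def2 in H2.
    unfold scal; simpl; unfold mult; simpl; fold (k s).
    rewrite Rabs_mult, (Rabs_pos_eq (weight m s)) by apply weight_ge0.
    assert (Hw := weight_ge0 m s).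
    replace (eps / 2 * (weight m s * k s)) with (weight m s * (eps / 2 * k s)) by ring.
    apply Rmult_le_compat_l; [easy|]. nra. }
rewrite avg_pos by easy.
replace (RInt (fun s => weight m s * f s) 0 y / (y ^ 2 * weight m y) - f 0)
  with (RInt (fun s => weight m s * g s) 0 y / (y ^ 2 * weight m y))
  by (rewrite HN; field; split; [apply Rgt_not_eq; now apply weight_gt0 | lra]).
unfold Rdiv; rewrite Rabs_mult, Rabs_inv, (Rabs_pos_eq (y ^ 2 * weight m y)) by lra.
apply Rle_lt_trans with (eps / 2); [|lra].
apply Rmult_le_reg_r with (1 := HE).
rewrite Rmult_assoc, Rinv_l by lra; lra.
Qed.

(** This is [(E L f)' = E f / y^2] solved for [(L f)'], with [E' / E = (1 + (1 - m) y) / y^2]. *)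
Lemma is_derive_avg (m : nat) (f : R -> R) (y : R) :
  (forall s, continuous f s) -> 0 < y ->
  is_derive (avg m f) y ((f y - (1 + (1 - INR m) * y) * avg m f y) / y ^ 2).
Proof.
intros Hf Hy.
apply is_derive_ext_loc with
  (fun y => RInt (fun s => weight m s * f s) 0 y / (y ^ 2 * weight m y)).
- exists (mkposreal y Hy); intros t Ht.
  symmetry; apply avg_pos.
  apply Rabs_def2 in Ht; unfold minus, plus, opp in Ht; simpl in Ht; lra.
- assert (HE := sq_weight_gt0 m y Hy). assert (Hw := weight_gt0 m y Hy).
  evar_last.
  + apply (is_derive_div (RInt (fun s => weight m s * f s) 0)
            (fun y => y ^ 2 * weight m y)).
    * apply is_derive_RInt_cont; intros s; now apply continuous_weight_mult.
    * apply is_derive_sq_weight.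
    * lra.
  + rewrite avg_pos by easy. simpl. field. split; lra.
Qed.

Lemma continuous_avg (m : nat) (f : R -> R) (y : R) :
  (forall s, continuous f s) -> continuous (avg m f) y.
Proof.
intros Hf; destruct (Rtotal_order y 0) as [Hy|[Hy|Hy]].
- apply continuous_ext_loc with (fun _ => f 0).
  + assert (Hp : 0 < - y) by lra.
    exists (mkposreal _ Hp); intros t Ht.
    symmetry; apply avg_nonpos.
    apply Rabs_def2 in Ht; unfold minus, plus, opp in Ht; simpl in Ht; lra.
  + apply continuous_const.
- subst y; now apply continuous_avg_0.
- apply (ex_derive_continuous (V := R_NormedModule)).
  eexists; now apply is_derive_avg.
Qed.

Lemma avg_linear (m : nat) (f g : R -> R) (c y : R) :
  (forall s, continuous f s) -> (forall s, continuous g s) ->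
  avg m (fun s => f s + c * g s) y = avg m f y + c * avg m g y.
Proof.
intros Hf Hg; unfold avg; destruct (Rle_dec y 0) as [Hy|Hy]; [easy|].
assert (HE := sq_weight_gt0 m y ltac:(lra)).
replace (RInt (fun s => weight m s * (f s + c * g s)) 0 y)
  with (RInt (fun s => weight m s * f s) 0 y
        + c * RInt (fun s => weight m s * g s) 0 y).
- field. split; [apply Rgt_not_eq, weight_gt0 |]; lra.
- rewrite <- (RInt_scal (V := R_CompleteNormedModule)) by now apply ex_RInt_weight.
  rewrite <- (RInt_plus (V := R_CompleteNormedModule)).
  + apply RInt_ext; intros s _; unfold plus, scal; simpl.
    unfold mult; simpl; ring.
  + now apply ex_RInt_weight.
  + apply (ex_RInt_scal (V := R_NormedModule)); now apply ex_RInt_weight.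
Qed.

Lemma avg_le (m : nat) (f : R -> R) (M y : R) :
  (forall s, continuous f s) -> 0 <= y ->
  (forall s, 0 <= s <= y -> Rabs (f s) <= M) ->
  Rabs (avg m f y) <= M * avg m (fun _ => 1) y.
Proof.
intros Hf Hy HM; destruct (Rle_dec y 0) as [Hy0|Hy0].
- rewrite !avg_nonpos by easy; rewrite Rmult_1_r; apply HM; lra.
- assert (HE := sq_weight_gt0 m y ltac:(lra)).
  rewrite !avg_pos by lra.
  unfold Rdiv; rewrite Rabs_mult, <- Rmult_assoc.
  rewrite Rabs_inv, (Rabs_pos_eq (y ^ 2 * weight m y)) by lra.
  apply Rmult_le_compat_r; [now apply Rlt_le, Rinv_0_lt_compat|].
  apply Rle_trans with (1 := abs_RInt_le _ _ _ Hy (ex_RInt_weight m f 0 y Hf)).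
  assert (H1 : forall s : R, continuous (fun _ : R => 1) s)
    by (intros; apply continuous_const).
  change (M * RInt (fun s => weight m s * 1) 0 y)
    with (scal M (RInt (fun s => weight m s * 1) 0 y)).
  rewrite <- (RInt_scal (V := R_CompleteNormedModule)) by now apply ex_RInt_weight.
  apply RInt_le.
  + easy.
  + apply ex_RInt_cont; intros s.
    apply (continuous_comp (fun s => weight m s * f s) Rabs).
    * now apply continuous_weight_mult.
    * apply continuous_Rabs.
  + apply (ex_RInt_scal (V := R_NormedModule)); now apply ex_RInt_weight.
  + intros s Hs. unfold scal; simpl; unfold mult; simpl.
    rewrite Rabs_mult, (Rabs_pos_eq (weight m s)) by apply weight_ge0.
    assert (Hw := weight_ge0 m s). assert (HMs := HM s ltac:(lra)). nra.
Qed.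

(** Positivity of the weight reduces the bound to [L 1], which is continuous on the compact
    interval. One constant therefore serves every [f]. *)
Lemma avg_bounded (m : nat) (Y : R) :
  exists B, 0 <= B /\ forall (f : R -> R) (M y : R),
    (forall s, continuous f s) -> 0 <= y <= Y ->
    (forall s, 0 <= s <= y -> Rabs (f s) <= M) ->
    Rabs (avg m f y) <= B * M.
Proof.
destruct (bounded_continuity (V := R_NormedModule) (avg m (fun _ => 1)) 0 Y) as [B HB].
{ intros y _; apply continuous_avg; intros; apply continuous_const. }
(* For [Y < 0] the interval is empty and the sign of [B] is unknown, hence the maximum with 0. *)
exists (Rmax 0 B); split; [apply Rmax_l|]; intros f M y Hf Hy HM.
apply Rle_trans with (1 := avg_le m f M y Hf (proj1 Hy) HM).
rewrite Rmult_comm; apply Rmult_le_compat_r.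
- apply Rle_trans with (1 := Rabs_pos (f 0)); apply HM; lra.
- apply Rle_trans with (1 := Rle_abs _).
  apply Rle_trans with B; [apply Rlt_le, HB; easy | apply Rmax_r].
Qed.

(** * The series solution *)

Lemma continuous_RInt_Rmax (f : R -> R) (y : R) :
  (forall s, continuous f s) ->
  continuous (fun y => RInt f 0 (Rmax 0 y)) y.
Proof.
intros Hf; apply (continuous_comp (Rmax 0) (RInt f 0)).
- apply continuous_at_iff; intros eps Heps; exists eps; split; [easy|].
  intros t Ht; apply Rle_lt_trans with (2 := Ht).
  unfold Rmax; destruct (Rle_dec 0 t), (Rle_dec 0 y);
    unfold Rabs; repeat destruct Rcase_abs; lra.
- apply (ex_derive_continuous (V := R_NormedModule)).
  eexists; now apply is_derive_RInt_cont.
Qed.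

(** The coefficient of [c^n] in [w_c(y)]. With [Rmax 0 y] each coefficient is constant to the left
    of 0, so it is continuous on the whole line. *)
Fixpoint iter_avg (m n : nat) (y : R) : R :=
  match n with
  | O => 1
  | S n => RInt (avg m (iter_avg m n)) 0 (Rmax 0 y)
  end.

Lemma continuous_iter_avg (m n : nat) (y : R) : continuous (iter_avg m n) y.
Proof.
revert y; induction n as [|n IH]; intros y.
- apply continuous_const.
- apply continuous_RInt_Rmax; intros s; now apply continuous_avg.
Qed.

Lemma RInt_pow_div_fact (B y : R) (n : nat) :
  RInt (fun s => B * (B ^ n * s ^ n / INR (fact n))) 0 y
  = B ^ S n * y ^ S n / INR (fact (S n)).
Proof.
assert (H1 := INR_fact_neq_0 n). assert (H2 := not_0_INR (S n) ltac:(lia)).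
assert (Hq : exists q, q = B ^ S n / INR (fact (S n))) by now eexists.
destruct Hq as [q Hq].
apply (is_RInt_unique (V := R_CompleteNormedModule)).
evar_last.
- apply (is_RInt_derive (V := R_CompleteNormedModule) (fun s => q * s ^ S n)).
  + intros s _. evar_last.
    * apply is_derive_scal, is_derive_pow, is_derive_id.
    * rewrite Hq, fact_simpl, mult_INR. change (Init.Nat.pred (S n)) with n.
      rewrite <- (tech_pow_Rmult B). unfold one; simpl.
      field. split; easy.
  + intros s _; apply (ex_derive_continuous (V := R_NormedModule)).
    auto_derive; easy.
- rewrite Hq; unfold minus, plus, opp; simpl; unfold Rdiv; ring.
Qed.

(** Picard estimate: each step multiplies by the bound [B] of [avg] and integrates, which produces
    the factorial. The induction keeps the dependence on [y]; only afterwards is [y] replaced by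
    [Y], giving [K = B * Y]. *)
Lemma iter_avg_bound (m : nat) (Y : R) :
  0 <= Y ->
  exists K, 0 <= K /\
    forall n y, y <= Y -> Rabs (iter_avg m n y) <= K ^ n / INR (fact n).
Proof.
intros HY; destruct (avg_bounded m Y) as [B [HB0 HB]].
assert (H : forall n y, y <= Y ->
  Rabs (iter_avg m n y) <= B ^ n * Rmax 0 y ^ n / INR (fact n)).
{ induction n as [|n IH]; intros y Hy.
  - simpl; rewrite Rabs_R1; lra.
  - simpl iter_avg. set (z := Rmax 0 y).
    assert (Hz : 0 <= z) by apply Rmax_l.
    assert (HzY : z <= Y) by now apply Rmax_lub.
    assert (Hc := fun s => continuous_avg m (iter_avg m n) s (continuous_iter_avg m n)).
    apply Rle_trans with (1 := abs_RInt_le _ _ _ Hz (ex_RInt_cont _ 0 z Hc)).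
    rewrite <- RInt_pow_div_fact. apply RInt_le.
    + easy.
    + apply ex_RInt_cont; intros s.
      apply (continuous_comp (avg m (iter_avg m n)) Rabs); [easy|].
      apply continuous_Rabs.
    + apply ex_RInt_cont; intros s.
      apply (ex_derive_continuous (V := R_NormedModule)). auto_derive; easy.
    + intros s Hs; apply HB; [apply continuous_iter_avg | lra |].
      intros t Ht; apply Rle_trans with (1 := IH t ltac:(lra)).
      rewrite Rmax_right by lra.
      apply Rmult_le_compat_r; [apply Rlt_le, Rinv_0_lt_compat, INR_fact_lt_0|].
      apply Rmult_le_compat_l; [now apply pow_le|].
      apply pow_incr; lra. }
exists (B * Y); split; [nra|]; intros n y Hy.
apply Rle_trans with (1 := H n y Hy).
apply Rmult_le_compat_r; [apply Rlt_le, Rinv_0_lt_compat, INR_fact_lt_0|].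
rewrite Rpow_mult_distr; apply Rmult_le_compat_l; [now apply pow_le|].
apply pow_incr; split; [apply Rmax_l | now apply Rmax_lub].
Qed.

(* [w_c(y)], for [0 <= y] *)
Definition sol (m : nat) (c y : R) : R := PSeries (fun n => iter_avg m n y) c.

Definition sol_sum (m : nat) (c : R) (n : nat) (y : R) : R :=
  sum_f_R0 (fun k => iter_avg m k y * c ^ k) n.

Lemma ex_series_exp (z : R) : ex_series (fun n => z ^ n / INR (fact n)).
Proof.
exists (exp z). generalize (is_exp_Reals z).
intros H; apply is_pseries_R in H.
revert H; apply is_series_ext; intros n; unfold Rdiv; apply Rmult_comm.
Qed.

(** Weierstrass test: the terms are dominated by those of the series of [exp (Rabs c * K)], whose
    tails do not depend on [y]. *)
Lemma sol_tail (m : nat) (c Y : R) :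
  0 <= Y ->
  exists r : nat -> R, is_lim_seq r 0 /\
    forall n y, y <= Y -> Rabs (sol m c y - sol_sum m c n y) <= r n.
Proof.
intros HY; destruct (iter_avg_bound m Y HY) as [K [HK0 HK]].
set (a := fun n => (Rabs c * K) ^ n / INR (fact n)).
assert (Ha : ex_series a) by apply ex_series_exp.
exists (fun n => Series (fun k => a (S n + k)%nat)); split.
- apply is_lim_seq_ext with (fun n => Series a - sum_n a n).
  { intros n; rewrite (Series_incr_n a (S n)) by (easy || lia).
    rewrite sum_n_Reals; simpl; ring. }
  replace (Finite 0) with (Finite (Series a - Series a)) by (f_equal; ring).
  apply is_lim_seq_minus'; [apply is_lim_seq_const|].
  now apply Series_correct.
- intros n y Hy.
  assert (Hle : forall k, Rabs (iter_avg m k y * c ^ k) <= a k).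
  { intros k; unfold a; rewrite Rabs_mult, <- RPow_abs, Rpow_mult_distr.
    specialize (HK k y Hy). assert (0 <= Rabs c ^ k) by apply pow_le, Rabs_pos.
    unfold Rdiv in *; nra. }
  assert (Hle' : ex_series (fun k => Rabs (iter_avg m k y * c ^ k))).
  { apply (ex_series_le (V := R_CompleteNormedModule)) with a; [|easy].
    intros k; unfold norm; simpl; unfold abs; simpl; rewrite Rabs_Rabsolu; apply Hle. }
  unfold sol, sol_sum, PSeries.
  rewrite (Series_incr_n _ (S n)) by (lia || now apply ex_series_Rabs).
  simpl Init.Nat.pred.
  match goal with |- Rabs (?u + ?v - ?u) <= _ =>
    replace (u + v - u) with v by ring end.
  assert (Hs : ex_series (fun k => Rabs (iter_avg m (S n + k) y * c ^ (S n + k)))).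
  { now apply (ex_series_incr_n (fun k => Rabs (iter_avg m k y * c ^ k)) (S n)). }
  apply Rle_trans with (1 := Series_Rabs _ Hs).
  apply Series_le.
  + intros k; split; [apply Rabs_pos | apply Hle].
  + now apply (ex_series_incr_n a (S n)).
Qed.

Lemma continuous_sol_sum (m : nat) (c : R) (n : nat) (y : R) :
  continuous (sol_sum m c n) y.
Proof.
revert y; induction n as [|n IH]; intros y.
- apply (continuous_mult (iter_avg m 0) (fun _ => c ^ 0));
    [apply continuous_iter_avg | apply continuous_const].
- apply (continuous_plus (V := R_NormedModule) (sol_sum m c n)); [apply IH|].
  apply (continuous_mult (iter_avg m (S n)) (fun _ => c ^ S n));
    [apply continuous_iter_avg | apply continuous_const].
Qed.

Lemma continuous_sol (m : nat) (c y : R) : continuous (sol m c) y.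
Proof.
apply continuous_at_iff; intros eps Heps.
destruct (sol_tail m c (Rabs y + 1)) as [r [Hr H]].
{ assert (H := Rabs_pos y); lra. }
assert (He : 0 < eps / 3) by lra.
apply is_lim_seq_spec in Hr; destruct (Hr (mkposreal _ He)) as [N HN].
specialize (HN N (Nat.le_refl N)); simpl in HN; rewrite Rminus_0_r in HN.
apply Rabs_def2 in HN.
destruct (proj1 (continuous_at_iff _ _) (continuous_sol_sum m c N y) (eps / 3) He)
  as [d [Hd Hd']].
exists (Rmin d 1); split; [apply Rmin_pos; lra|]; intros t Ht.
assert (Hm1 := Rmin_l d 1); assert (Hm2 := Rmin_r d 1).
specialize (Hd' t ltac:(lra)).
assert (H1 := H N y ltac:(assert (H1 := Rle_abs y); lra)).
assert (H2 : t <= Rabs y + 1).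
{ assert (H3 := Rle_abs y). assert (H4 := Rle_abs (t - y)). lra. }
specialize (H N t H2).
apply Rabs_def2 in Hd'. apply Rabs_le_between in H1, H.
apply Rabs_def1; lra.
Qed.

Lemma avg_ext (m : nat) (f g : R -> R) (y : R) :
  (forall s, f s = g s) -> avg m f y = avg m g y.
Proof.
intros H; unfold avg; destruct (Rle_dec y 0); [apply H|].
f_equal; apply RInt_ext; intros s _; now rewrite H.
Qed.

Lemma sol_sum_S (m : nat) (c : R) (n : nat) (y : R) :
  sol_sum m c (S n) y = 1 + c * RInt (avg m (sol_sum m c n)) 0 (Rmax 0 y).
Proof.
induction n as [|n IH].
- unfold sol_sum at 1; simpl.
  rewrite (RInt_ext (avg m (sol_sum m c 0)) (avg m (fun _ => 1))); [ring|].
  intros s _; apply avg_ext; intros t; unfold sol_sum; simpl; ring.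
- unfold sol_sum at 1; rewrite tech5; fold (sol_sum m c (S n) y); rewrite IH.
  rewrite (RInt_ext (avg m (sol_sum m c (S n)))
    (fun s => plus (avg m (sol_sum m c n) s)
                   (scal (c ^ S n) (avg m (iter_avg m (S n)) s)))).
  + rewrite (RInt_plus (V := R_CompleteNormedModule)).
    * rewrite (RInt_scal (V := R_CompleteNormedModule)).
      -- unfold plus, scal; simpl; unfold mult; simpl. ring.
      -- apply ex_RInt_cont; intros s; apply continuous_avg; intros.
         apply continuous_iter_avg.
    * apply ex_RInt_cont; intros s; apply continuous_avg; intros.
      apply continuous_sol_sum.
    * apply (ex_RInt_scal (V := R_NormedModule)).
      apply ex_RInt_cont; intros s; apply continuous_avg; intros.
      apply continuous_iter_avg.
  + intros s _. rewrite (avg_ext m (sol_sum m c (S n))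
      (fun s => sol_sum m c n s + c ^ S n * iter_avg m (S n) s)).
    * now rewrite avg_linear by
        (intros; apply continuous_sol_sum || apply continuous_iter_avg).
    * intros t; unfold sol_sum; rewrite tech5; ring.
Qed.

(** Limit of the recurrence [sol_sum_S]. The tail bound controls the left side, and [avg_bounded]
    carries it through the operator and the integral on the right. *)
Lemma sol_fixed_point (m : nat) (c y : R) :
  sol m c y = 1 + c * RInt (avg m (sol m c)) 0 (Rmax 0 y).
Proof.
set (z := Rmax 0 y).
assert (Hz : 0 <= z) by apply Rmax_l.
destruct (sol_tail m c z Hz) as [r [Hr H]].
destruct (avg_bounded m z) as [B [HB0 HB]].
assert (Hy : y <= z) by apply Rmax_r.
set (I := RInt (avg m (sol m c)) 0 z).
assert (Hn : forall n, Rabs (sol m c y - (1 + c * I))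
               <= r (S n) + Rabs c * (z * (B * r n))).
{ intros n.
  replace (sol m c y - (1 + c * I)) with
    ((sol m c y - sol_sum m c (S n) y)
     + c * (RInt (fun s => avg m (sol_sum m c n) s + -1 * avg m (sol m c) s) 0 z)).
  - apply Rle_trans with (1 := Rabs_triang _ _).
    apply Rplus_le_compat; [now apply H|].
    rewrite Rabs_mult; apply Rmult_le_compat_l; [apply Rabs_pos|].
    rewrite <- (Rminus_0_r z) at 2.
    apply abs_RInt_le_const; [easy| |].
    + apply ex_RInt_cont; intros s.
      apply continuous_ext with (avg m (fun t => sol_sum m c n t + -1 * sol m c t)).
      * intros t; apply avg_linear; intros;
          [apply continuous_sol_sum | apply continuous_sol].
      * apply continuous_avg; intros t.
        apply (continuous_plus (V := R_NormedModule)); [apply continuous_sol_sum|].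
        apply (continuous_mult (fun _ => -1)); [apply continuous_const|].
        apply continuous_sol.
    + intros t Ht. rewrite <- avg_linear by
        (intros; apply continuous_sol_sum || apply continuous_sol).
      apply HB; [| lra |].
      * intros s; apply (continuous_plus (V := R_NormedModule)); [apply continuous_sol_sum|].
        apply (continuous_mult (fun _ => -1)); [apply continuous_const|].
        apply continuous_sol.
      * intros s Hs. rewrite <- Rabs_Ropp.
        replace (- (sol_sum m c n s + -1 * sol m c s))
          with (sol m c s - sol_sum m c n s) by ring.
        apply H; lra.
  - rewrite sol_sum_S; fold z.
    rewrite (RInt_ext (fun s => avg m (sol_sum m c n) s + -1 * avg m (sol m c) s)
      (fun s => plus (avg m (sol_sum m c n) s) (scal (-1) (avg m (sol m c) s))))
      by (intros s _; reflexivity).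
    rewrite (RInt_plus (V := R_CompleteNormedModule)), (RInt_scal (V := R_CompleteNormedModule)).
    + unfold plus, scal; simpl; unfold mult; simpl; unfold I. ring.
    + apply ex_RInt_cont; intros s; apply continuous_avg; intros; apply continuous_sol.
    + apply ex_RInt_cont; intros s; apply continuous_avg; intros; apply continuous_sol_sum.
    + apply (ex_RInt_scal (V := R_NormedModule)).
      apply ex_RInt_cont; intros s; apply continuous_avg; intros; apply continuous_sol. }
assert (Hl : is_lim_seq (fun n => r (S n) + Rabs c * (z * (B * r n)))
               (0 + Rabs c * (z * (B * 0)))).
{ apply is_lim_seq_plus'; [now apply (is_lim_seq_incr_1 r)|].
  repeat apply (is_lim_seq_scal_l _ _ (Finite _)). easy. }
assert (Hle := is_lim_seq_le _ _ _ _ Hn (is_lim_seq_const _) Hl).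
simpl in Hle.
assert (H0 := Rabs_pos (sol m c y - (1 + c * I))).
assert (H1 : Rabs (sol m c y - (1 + c * I)) = 0) by lra.
destruct (Req_dec (sol m c y - (1 + c * I)) 0) as [H2|H2]; [lra|].
now apply Rabs_no_R0 in H2.
Qed.

Lemma sol_0 (m : nat) (c : R) : sol m c 0 = 1.
Proof.
rewrite sol_fixed_point, Rmax_left by lra.
rewrite (RInt_point (V := R_CompleteNormedModule)). unfold zero; simpl; ring.
Qed.

Lemma is_derive_RInt_Rmax (f : R -> R) (y : R) :
  (forall s, continuous f s) -> 0 < y ->
  is_derive (fun y => RInt f 0 (Rmax 0 y)) y (f y).
Proof.
intros Hf Hy; apply is_derive_ext_loc with (RInt f 0).
- exists (mkposreal y Hy); intros t Ht.
  apply Rabs_def2 in Ht; unfold minus, plus, opp in Ht; simpl in Ht.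
  now rewrite Rmax_right by lra.
- now apply is_derive_RInt_cont.
Qed.

Lemma is_derive_sol (m : nat) (c y : R) :
  0 < y -> is_derive (sol m c) y (c * avg m (sol m c) y).
Proof.
intros Hy.
apply is_derive_ext with (fun y => 1 + c * RInt (avg m (sol m c)) 0 (Rmax 0 y)).
{ intros t; symmetry; apply sol_fixed_point. }
evar_last.
- apply (is_derive_plus (V := R_NormedModule) (fun _ => 1)).
  + apply is_derive_const.
  + apply is_derive_scal, is_derive_RInt_Rmax; [|easy].
    intros; apply continuous_avg; intros; apply continuous_sol.
- unfold plus, zero; simpl; ring.
Qed.

(** The derivative of a power series at its centre is the coefficient of order 1, once the radius of
    convergence is positive. *)
Lemma is_derive_sol_parameter (m : nat) (y : R) :
  is_derive (fun c => sol m c y) 0 (iter_avg m 1 y).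
Proof.
evar_last.
- apply is_derive_PSeries.
  destruct (iter_avg_bound m (Rmax 0 y) (Rmax_l _ _)) as [K [HK0 HK]].
  rewrite Rabs_R0.
  (* With radius 0 the terms at [c = 1] could not tend to 0, yet they are bounded by
     [K ^ n / INR (fact n)]. *)
  apply Rbar_not_le_lt; intros Hle.
  apply (CV_disk_outside (fun n => iter_avg m n y) 1).
  + rewrite Rabs_R1; apply Rbar_le_lt_trans with (1 := Hle); simpl; lra.
  + apply ex_series_lim_0.
    apply (ex_series_le (V := R_CompleteNormedModule))
      with (fun n => K ^ n / INR (fact n)); [|apply ex_series_exp].
    intros n; rewrite pow1, Rmult_1_r; apply HK, Rmax_r.
- rewrite PSeries_0; unfold PS_derive; simpl; ring.
Qed.

(** * Kummer's equation and the Tricomi function *)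

Lemma is_derive_Rpower (p x : R) :
  0 < x -> is_derive (fun x => Rpower x p) x (p / x * Rpower x p).
Proof. intros Hx; unfold Rpower; auto_derive; [easy|]; field; lra. Qed.

Lemma kummer_solution_intro (a b : R) (f f1 f2 : R -> R) :
  (forall x, 0 < x -> is_derive f x (f1 x)) ->
  (forall x, 0 < x -> is_derive f1 x (f2 x)) ->
  (forall x, 0 < x -> x * f2 x + (b - x) * f1 x - a * f x = 0) ->
  kummer_solution a b f.
Proof.
intros H1 H2 H x Hx.
assert (H' : is_derive (Derive f) x (f2 x)).
{ apply is_derive_ext_loc with f1; [|now apply H2].
  exists (mkposreal x Hx); intros t Ht.
  apply Rabs_def2 in Ht; unfold minus, plus, opp in Ht; simpl in Ht.
  symmetry; apply is_derive_unique, H1; lra. }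
split; [eexists; now apply H1|]. split; [now exists (f2 x)|].
change (Derive_n f 2 x) with (Derive (Derive f) x).
rewrite (is_derive_unique _ _ _ H'), (is_derive_unique _ _ _ (H1 x Hx)).
now apply H.
Qed.

Lemma is_derive_comp_inv (g : R -> R) (l x : R) :
  0 < x -> is_derive g (/ x) l -> is_derive (fun x => g (/ x)) x (- l / x ^ 2).
Proof.
intros Hx Hg; evar_last.
- apply (is_derive_comp g Rinv); [exact Hg|].
  apply is_derive_inv; [apply is_derive_id | lra].
- unfold scal, one; simpl; unfold mult, one; simpl. field; lra.
Qed.

(** In the variable [x], the functions [v] and [g] form a closed linear first-order system. Both
    derivatives of the product are thus combinations of [v] and [g], and Kummer's equation becomes a
    rational identity that holds because [c = a * (INR m + a)]. *)
Lemma kummer_solution_sol (m : nat) (a : R) :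
  kummer_solution a (1 + INR m + 2 * a)
    (fun x => Rpower x (- a) * sol m (a * (INR m + a)) (/ x)).
Proof.
set (c := a * (INR m + a)).
set (v := fun x => sol m c (/ x)). set (g := fun x => avg m (sol m c) (/ x)).
assert (Hv : forall x, 0 < x -> is_derive v x (- (c * g x) / x ^ 2)).
{ intros x Hx; apply is_derive_comp_inv; [easy|].
  now apply is_derive_sol, Rinv_0_lt_compat. }
assert (Hg : forall x, 0 < x ->
  is_derive g x (- (v x - (1 + (1 - INR m) / x) * g x))).
{ intros x Hx; evar_last.
  - apply is_derive_comp_inv; [easy|].
    apply is_derive_avg; [intros; apply continuous_sol | now apply Rinv_0_lt_compat].
  - fold (v x) (g x). field; lra. }
apply kummer_solution_intro with
  (fun x => Rpower x (- a) * (- a / x * v x - c * g x / x ^ 2))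
  (fun x => Rpower x (- a) *
     (- a / x * (- a / x * v x - c * g x / x ^ 2)
      + (a / x ^ 2 * v x + a * c * g x / x ^ 3
         + c * (v x - (1 + (1 - INR m) / x) * g x) / x ^ 2 + 2 * c * g x / x ^ 3))).
- intros x Hx; evar_last.
  + apply (is_derive_mult (fun x => Rpower x (- a)) v);
      [now apply is_derive_Rpower | now apply Hv | intros; apply Rmult_comm].
  + unfold plus, mult; simpl; field; lra.
- intros x Hx; evar_last.
  + apply (is_derive_mult (fun x => Rpower x (- a))
      (fun x => - a / x * v x - c * g x / x ^ 2));
      [now apply is_derive_Rpower | | intros; apply Rmult_comm].
    specialize (Hv x Hx). specialize (Hg x Hx).
    auto_derive.
    * repeat split; try (eexists; eassumption); try easy; nra.
    * rewrite (is_derive_unique _ _ _ Hv : Derive (fun x => v x) x = _),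
        (is_derive_unique _ _ _ Hg : Derive (fun x => g x) x = _).
      reflexivity.
  + unfold plus, mult; simpl; field; lra.
- intros x Hx; fold (v x); unfold c; field; lra.
Qed.

Lemma is_tricomi_U_sol (m : nat) (a : R) :
  is_tricomi_U a (1 + INR m + 2 * a)
    (fun x => Rpower x (- a) * sol m (a * (INR m + a)) (/ x)).
Proof.
split; [apply kummer_solution_sol|].
apply is_lim_ext_loc with (fun x => sol m (a * (INR m + a)) (/ x)).
- exists 0; intros x Hx.
  rewrite <- Rmult_assoc, <- Rpower_plus, Rplus_opp_r, Rpower_O by easy; ring.
- apply filterlim_comp with (locally 0).
  + apply (is_lim_inv (fun x => x) p_infty p_infty); [apply is_lim_id | easy].
  + simpl. rewrite <- (sol_0 m (a * (INR m + a))). apply continuous_sol.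
Qed.

(** * Uniqueness of the solution normalised at infinity *)

Lemma kummer_solution_derive (a b : R) (f : R -> R) (x : R) :
  kummer_solution a b f -> 0 < x ->
  is_derive f x (Derive f x) /\
  is_derive (Derive f) x ((a * f x - (b - x) * Derive f x) / x).
Proof.
intros Hf Hx; destruct (Hf x Hx) as [H1 [H2 H3]]; split; [now apply Derive_correct|].
replace ((a * f x - (b - x) * Derive f x) / x) with (Derive (Derive f) x);
  [now apply Derive_correct|].
change (Derive_n f 2 x) with (Derive (Derive f) x) in H3.
apply Rmult_eq_reg_l with x; [|lra].
replace (x * ((a * f x - (b - x) * Derive f x) / x))
  with (a * f x - (b - x) * Derive f x) by (field; lra).
lra.
Qed.

(** Abel's identity: [x^b e^(-x)] is the integrating factor, and its product with the Wronskian has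
    derivative 0. *)
Lemma wronskian_kummer (a b : R) (f g : R -> R) :
  kummer_solution a b f -> kummer_solution a b g ->
  exists C, forall x, 0 < x ->
    f x * Derive g x - g x * Derive f x = C * (Rpower x (- b) * exp x).
Proof.
intros Hf Hg.
set (F := fun x => Rpower x b * exp (- x) * (f x * Derive g x - g x * Derive f x)).
assert (HF : forall x, 0 < x -> is_derive F x 0).
{ intros x Hx.
  destruct (kummer_solution_derive a b f x Hf Hx) as [Hf1 Hf2].
  destruct (kummer_solution_derive a b g x Hg Hx) as [Hg1 Hg2].
  evar_last.
  - apply (is_derive_mult (fun x => Rpower x b * exp (- x))
      (fun x => f x * Derive g x - g x * Derive f x)).
    + apply (is_derive_mult (fun x => Rpower x b) (fun x => exp (- x)) x
        (b / x * Rpower x b) (- exp (- x)));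
        [now apply is_derive_Rpower | | intros; apply Rmult_comm].
      auto_derive; [easy|ring].
    + apply (is_derive_minus (fun x => f x * Derive g x) (fun x => g x * Derive f x)).
      * apply (is_derive_mult f (Derive g)); [exact Hf1 | exact Hg2 | intros; apply Rmult_comm].
      * apply (is_derive_mult g (Derive f)); [exact Hg1 | exact Hf2 | intros; apply Rmult_comm].
    + intros; apply Rmult_comm.
  - unfold minus, plus, opp, mult; simpl; field; lra. }
exists (F 1); intros x Hx.
assert (HF1 : F x = F 1).
{ destruct (Rtotal_order x 1) as [H|[->|H]]; [|easy|symmetry];
    (apply (eq_is_derive (V := R_NormedModule)); [|easy]);
    intros t Ht; apply HF; lra. }
rewrite <- HF1; unfold F.
replace (Rpower x b * exp (- x) * (f x * Derive g x - g x * Derive f x)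
          * (Rpower x (- b) * exp x))
  with ((Rpower x b * Rpower x (- b)) * (exp (- x) * exp x)
        * (f x * Derive g x - g x * Derive f x)) by ring.
rewrite <- Rpower_plus, <- exp_plus, Rplus_opp_r, Rplus_opp_l, exp_0, Rpower_O by easy.
ring.
Qed.

Lemma Rpower_exp_ge_1 (p : R) :
  exists X, 1 <= X /\ forall x, X <= x -> 1 <= Rpower x p * exp x.
Proof.
destruct (nfloor_ex (Rabs p) (Rabs_pos p)) as [n [_ Hn]].
(* Since [Rabs p < n + 1], the power is at least [/ x ^ S n]. Against the Taylor term of order
   [n + 2] this leaves [x / INR (fact (n + 2))]. *)
exists (INR (fact (n + 2))).
assert (HF : 1 <= INR (fact (n + 2))) by apply (le_INR 1), lt_O_fact.
split; [easy|]; intros x Hx.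
assert (Hx1 : 0 < x) by lra.
assert (Hp : / x ^ S n <= Rpower x p).
{ rewrite <- Rpower_pow, <- Rpower_Ropp by easy.
  apply Rle_Rpower; [lra|]. rewrite S_INR.
  assert (H := Rabs_maj2 p). lra. }
assert (He := pow_div_fact_le_exp (n + 2) x ltac:(lra)).
assert (Hxn : 0 < x ^ S n) by now apply pow_lt.
apply Rle_trans with (/ x ^ S n * (x ^ (n + 2) / INR (fact (n + 2)))).
- replace (n + 2)%nat with (S (S n)) at 1 by lia.
  rewrite <- (tech_pow_Rmult x (S n)).
  replace (/ x ^ S n * (x * x ^ S n / INR (fact (n + 2))))
    with (x / INR (fact (n + 2))) by (field; lra).
  apply Rle_div_r; lra.
- apply Rmult_le_compat; [|apply Rdiv_le_0_compat; [now apply pow_le, Rlt_le|lra]| |];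
    [now apply Rlt_le, Rinv_0_lt_compat | easy | easy].
Qed.

(** By the Wronskian, [(g / f)' = C x^(-b) e^x / f^2], which stays away from 0 for large [x] if [C]
    is not 0, whereas [g / f] stays bounded. The conclusion concerns large [x] only, where [f] is
    known not to vanish. *)
Lemma kummer_eventually_proportional (a b : R) (f g : R -> R) :
  kummer_solution a b f -> kummer_solution a b g ->
  is_lim (fun x => Rpower x a * f x) p_infty 1 ->
  is_lim (fun x => Rpower x a * g x) p_infty 1 ->
  exists X q, 0 < X /\ forall x, X <= x -> g x = q * f x.
Proof.
intros Hf Hg Lf Lg.
destruct (wronskian_kummer a b f g Hf Hg) as [C HC].
assert (H12 : 0 < 1 / 2) by lra.
apply is_lim_spec in Lf; apply is_lim_spec in Lg.
destruct (Lf (mkposreal _ H12)) as [X1 HX1].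
destruct (Lg (mkposreal _ H12)) as [X2 HX2]. simpl in HX1, HX2.
destruct (Rpower_exp_ge_1 (2 * a - b)) as [X3 [HX31 HX3]].
set (X := Rmax X3 (Rmax X1 X2 + 1)).
assert (HXX : X3 <= X /\ X1 < X /\ X2 < X).
{ unfold X; assert (H1 := Rmax_l X3 (Rmax X1 X2 + 1)).
  assert (H2 := Rmax_r X3 (Rmax X1 X2 + 1)).
  assert (H3 := Rmax_l X1 X2). assert (H4 := Rmax_r X1 X2). lra. }
assert (Bf : forall x, X <= x -> 1 / 2 < Rpower x a * f x < 3 / 2).
{ intros x Hx; specialize (HX1 x ltac:(lra)); apply Rabs_def2 in HX1; lra. }
assert (Bg : forall x, X <= x -> 1 / 2 < Rpower x a * g x < 3 / 2).
{ intros x Hx; specialize (HX2 x ltac:(lra)); apply Rabs_def2 in HX2; lra. }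
assert (Hpow : forall x, 0 < Rpower x a) by (intros; apply exp_pos).
assert (Nf : forall x, X <= x -> f x <> 0).
{ intros x Hx H0; specialize (Bf x Hx); rewrite H0 in Bf; lra. }
assert (Hq : forall x, X <= x ->
  is_derive (fun x => g x / f x) x (C * (Rpower x (- b) * exp x) / f x ^ 2)).
{ intros x Hx. assert (Hx0 : 0 < x) by lra.
  destruct (kummer_solution_derive a b f x Hf Hx0) as [Hf1 _].
  destruct (kummer_solution_derive a b g x Hg Hx0) as [Hg1 _].
  rewrite <- HC by easy. evar_last.
  - apply (is_derive_div g f); [exact Hg1 | exact Hf1 | now apply Nf].
  - field; now apply Nf. }
assert (HC0 : C = 0).
{ destruct (Req_dec C 0) as [|HC0]; [easy|exfalso].
  assert (Ha : 0 < Rabs C) by now apply Rabs_pos_lt.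
  assert (Bq : forall x, X <= x -> 0 < g x / f x < 3).
  { intros x Hx; specialize (Bf x Hx); specialize (Bg x Hx).
    replace (g x / f x) with ((Rpower x a * g x) / (Rpower x a * f x)).
    - split; [apply Rdiv_lt_0_compat; lra|].
      apply Rlt_div_l; lra.
    - field; split; [now apply Nf | apply Rgt_not_eq, Hpow]. }
  (* The derivative will have absolute value at least [4 / 9 * Rabs C], so over length [h] the
     quotient varies by at least 4, more than the range [(0, 3)] allows. *)
  set (h := 9 / Rabs C).
  assert (Hh : 0 < h) by (apply Rdiv_lt_0_compat; lra).
  destruct (MVT_gen (fun x => g x / f x) X (X + h)
    (fun x => C * (Rpower x (- b) * exp x) / f x ^ 2)) as [t [Ht E]].
  - intros x; rewrite Rmin_left, Rmax_right by lra; intros Hx; apply Hq; lra.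
  - intros x; rewrite Rmin_left, Rmax_right by lra; intros Hx.
    apply continuity_pt_filterlim.
    apply (ex_derive_continuous (V := R_NormedModule) (fun x => g x / f x)).
    eexists; apply Hq; lra.
  - rewrite Rmin_left, Rmax_right in Ht by lra.
    assert (B1 := Bq X ltac:(lra)). assert (B2 := Bq (X + h) ltac:(lra)).
    assert (Bt := Bf t ltac:(lra)). assert (E3 := HX3 t ltac:(lra)).
    assert (Ht0 : 0 < t) by lra.
    (* Multiply numerator and denominator by [t^(2a)]: the numerator becomes at least 1 by [E3], and
       the denominator [(t^a f)^2] is below [9 / 4]. *)
    assert (HK : 4 / 9 <= Rpower t (- b) * exp t / f t ^ 2).
    { assert (Hft : 0 < f t).
      { destruct (Rle_dec (f t) 0); [|lra]. specialize (Hpow t). nra. }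
      replace (2 * a - b) with (a + a + - b) in E3 by ring.
      rewrite !Rpower_plus in E3.
      apply (Rle_div_r (4 / 9)); [now apply pow_lt|].
      set (u := Rpower t a) in *. specialize (Hpow t); fold u in Hpow.
      set (w := Rpower t (- b) * exp t) in *.
      assert (Hw : 0 < w) by (apply Rmult_lt_0_compat; apply exp_pos).
      replace (u * u * Rpower t (- b) * exp t) with (u ^ 2 * w) in E3 by (unfold w; ring).
      apply Rmult_le_reg_l with (u ^ 2); [now apply pow_lt|].
      replace (u ^ 2 * (4 / 9 * f t ^ 2)) with (4 / 9 * (u * f t) ^ 2) by ring.
      nra. }
    assert (HE : Rabs (g (X + h) / f (X + h) - g X / f X)
                 = Rabs C * (Rpower t (- b) * exp t / f t ^ 2) * h).
    { rewrite E.
      replace (X + h - X) with h by ring.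
      replace (C * (Rpower t (- b) * exp t) / f t ^ 2 * h)
        with (C * (Rpower t (- b) * exp t / f t ^ 2) * h)
        by (unfold Rdiv; ring).
      rewrite !Rabs_mult, (Rabs_pos_eq h), (Rabs_pos_eq (_ / _)) by lra; easy. }
    assert (HE2 : Rabs (g (X + h) / f (X + h) - g X / f X) < 3)
      by (apply Rabs_def1; lra).
    rewrite HE in HE2.
    replace (Rabs C * (Rpower t (- b) * exp t / f t ^ 2) * h)
      with (9 * (Rpower t (- b) * exp t / f t ^ 2)) in HE2; [lra|].
    unfold h; field. split; [lra | apply Nf; lra]. }
exists X, (g X / f X); split; [lra|]; intros x Hx.
assert (E : g X / f X = g x / f x).
{ destruct (Rle_lt_or_eq_dec X x Hx) as [H|<-]; [|easy].
  apply (eq_is_derive (V := R_NormedModule) (fun x => g x / f x)); [|easy].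
  intros t Ht; evar_last; [apply Hq; lra|].
  rewrite HC0; unfold zero; simpl; unfold Rdiv; ring. }
rewrite E; field; now apply Nf.
Qed.

(* Backwards Gronwall estimate for the energy [d ^ 2 + (d') ^ 2] of the
   difference [d] of the two solutions. *)
Lemma kummer_solution_backward_unique (a b X : R) (f g : R -> R) :
  kummer_solution a b f -> kummer_solution a b g ->
  f X = g X -> Derive f X = Derive g X ->
  forall x, 0 < x <= X -> f x = g x.
Proof.
intros Hf Hg H0 H1 x Hx.
set (d := fun t => f t - g t). set (d1 := fun t => Derive f t - Derive g t).
(* On [[x, X]], [M] bounds both coefficients [a / t] and [(b - t) / t] of the equation. With
   [K = 1 + 3 M] the energy times [exp (K * t)] is nondecreasing; it vanishes at [X], so it is at
   most 0 at [x]. *)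
set (M := (Rabs a + Rabs b + X) / x).
set (K := 1 + 3 * M).
set (dE := fun t => exp (K * t) *
  (K * (d t ^ 2 + d1 t ^ 2) + 2 * d t * d1 t
   + 2 * d1 t * ((a * d t - (b - t) * d1 t) / t))).
assert (HE : forall t, x <= t -> is_derive
  (fun t => exp (K * t) * (d t ^ 2 + d1 t ^ 2)) t (dE t)).
{ intros t Ht; assert (Ht0 : 0 < t) by lra.
  destruct (kummer_solution_derive a b f t Hf Ht0) as [Hf1 Hf2].
  destruct (kummer_solution_derive a b g t Hg Ht0) as [Hg1 Hg2].
  assert (Hd : is_derive d t (d1 t)) by now apply (is_derive_minus f g).
  assert (Hd1 : is_derive d1 t ((a * d t - (b - t) * d1 t) / t)).
  { evar_last; [apply (is_derive_minus (Derive f) (Derive g)); eassumption|].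
    unfold minus, plus, opp, d, d1; simpl; field; lra. }
  auto_derive.
  - repeat split; try (eexists; eassumption).
  - rewrite (is_derive_unique _ _ _ Hd : Derive (fun x => d x) t = _),
      (is_derive_unique _ _ _ Hd1 : Derive (fun x => d1 x) t = _).
    unfold dE; field; lra. }
assert (Hpos : forall t, x <= t <= X -> 0 <= dE t).
{ intros t Ht; apply Rmult_le_pos; [apply Rlt_le, exp_pos|].
  assert (HM0 : 0 <= M).
  { apply Rdiv_le_0_compat; [|lra].
    assert (H2 := Rabs_pos a); assert (H3 := Rabs_pos b); lra. }
  assert (Ha : Rabs (a / t) <= M).
  { unfold Rdiv, M; rewrite Rabs_mult, Rabs_inv, (Rabs_pos_eq t) by lra.
    apply Rmult_le_compat; [apply Rabs_pos | apply Rlt_le, Rinv_0_lt_compat; lra | |].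
    - assert (H3 := Rabs_pos b); lra.
    - apply Rinv_le_contravar; lra. }
  assert (Hb : Rabs ((b - t) / t) <= M).
  { unfold Rdiv, M; rewrite Rabs_mult, Rabs_inv, (Rabs_pos_eq t) by lra.
    apply Rmult_le_compat; [apply Rabs_pos | apply Rlt_le, Rinv_0_lt_compat; lra | |].
    - assert (H2 := Rabs_pos a). assert (H3 := Rabs_triang b (- t)).
      rewrite Rabs_Ropp, (Rabs_pos_eq t) in H3 by lra. unfold Rminus. lra.
    - apply Rinv_le_contravar; lra. }
  replace ((a * d t - (b - t) * d1 t) / t)
    with (a / t * d t - (b - t) / t * d1 t) by (field; lra).
  apply Rabs_le_between in Ha, Hb.
  set (A := a / t) in *. set (B := (b - t) / t) in *.
  set (u := d t). set (w := d1 t). unfold K.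
  (* The cross term is absorbed through the squares of [u + w] and [u - w], whose coefficients are
     nonnegative because [- M <= A <= M]. *)
  assert (Hc : 0 <= (1 + A) * (u * w) + (1 + M) / 2 * (u ^ 2 + w ^ 2)).
  { assert (0 <= (1 + M + (1 + A)) * (u + w) ^ 2) by (apply Rmult_le_pos; [lra | apply pow2_ge_0]).
    assert (0 <= (1 + M - (1 + A)) * (u - w) ^ 2) by (apply Rmult_le_pos; [lra | apply pow2_ge_0]).
    lra. }
  assert (Hc2 : 0 <= (M - B) * w ^ 2) by (apply Rmult_le_pos; [lra | apply pow2_ge_0]).
  assert (Hc3 : 0 <= M * u ^ 2) by (apply Rmult_le_pos; [lra | apply pow2_ge_0]).
  assert (Hc4 : 0 <= M * w ^ 2) by (apply Rmult_le_pos; [lra | apply pow2_ge_0]).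
  lra. }
destruct (MVT_gen (fun t => exp (K * t) * (d t ^ 2 + d1 t ^ 2)) x X dE)
  as [t [Ht E]].
- intros t; rewrite Rmin_left by lra; intros Ht; apply HE; lra.
- intros t; rewrite Rmin_left by lra; intros Ht.
  apply continuity_pt_filterlim.
  apply (ex_derive_continuous (V := R_NormedModule)
    (fun t => exp (K * t) * (d t ^ 2 + d1 t ^ 2))).
  eexists; apply HE; lra.
- rewrite Rmin_left, Rmax_right in Ht by lra.
  assert (HdX : d X = 0) by (unfold d; lra).
  assert (Hd1X : d1 X = 0) by (unfold d1; lra).
  rewrite HdX, Hd1X in E.
  assert (Hp := Rmult_le_pos _ _ (Hpos t Ht) (ltac:(lra) : 0 <= X - x)).
  assert (He := exp_pos (K * x)).
  assert (Hdx : d x ^ 2 + d1 x ^ 2 <= 0).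
  { apply Rmult_le_reg_l with (exp (K * x)); [easy|]. lra. }
  assert (Hdx0 : d x = 0).
  { assert (H2 := pow2_ge_0 (d x)). assert (H3 := pow2_ge_0 (d1 x)).
    apply Rsqr_0_uniq; unfold Rsqr; lra. }
  unfold d in Hdx0; lra.
Qed.

Lemma is_tricomi_U_unique (a b : R) (f g : R -> R) :
  is_tricomi_U a b f -> is_tricomi_U a b g -> forall x, 0 < x -> f x = g x.
Proof.
intros [Hf Lf] [Hg Lg] x Hx.
destruct (kummer_eventually_proportional a b f g Hf Hg Lf Lg) as [X [q [HX Hq]]].
assert (Hq1 : q = 1).
{ assert (L : is_lim (fun x => Rpower x a * g x) p_infty (q * 1)).
  { apply is_lim_ext_loc with (fun x => q * (Rpower x a * f x)).
    - exists X; intros t Ht; rewrite (Hq t) by lra; ring.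
    - now apply (is_lim_scal_l _ q _ (Finite 1)). }
  apply is_lim_unique in Lg; apply is_lim_unique in L.
  rewrite Lg in L; injection L; lra. }
subst q.
(* [Y] is strictly beyond [X], so the solutions agree in a neighbourhood of [Y] and their
   derivatives agree there too. *)
set (Y := Rmax x (X + 1)).
assert (HY : x <= Y /\ X < Y).
{ unfold Y; assert (H1 := Rmax_l x (X + 1)); assert (H2 := Rmax_r x (X + 1)); lra. }
apply (kummer_solution_backward_unique a b Y f g Hf Hg); [| |lra].
- rewrite Hq by lra; ring.
- apply Derive_ext_loc.
  assert (Hp : 0 < Y - X) by lra.
  exists (mkposreal _ Hp); intros t Ht.
  apply Rabs_def2 in Ht; unfold minus, plus, opp in Ht; simpl in Ht.
  rewrite Hq by lra; ring.
Qed.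

(** * The Tricomi and Whittaker functions through the series solution *)

(** The series solution is a witness for the choice operator, so the chosen function satisfies the
    specification, and uniqueness identifies the two for [0 < x]. *)
Lemma tricomi_U_eq_sol (m : nat) (a x : R) :
  0 < x ->
  tricomi_U a (1 + INR m + 2 * a) x
  = Rpower x (- a) * sol m (a * (INR m + a)) (/ x).
Proof.
intros Hx; apply (is_tricomi_U_unique a (1 + INR m + 2 * a) _
  (fun x => Rpower x (- a) * sol m (a * (INR m + a)) (/ x))); [| |easy].
- unfold tricomi_U; apply epsilon_spec; eexists; apply is_tricomi_U_sol.
- apply is_tricomi_U_sol.
Qed.

Lemma whittaker_W_eq_sol (m : nat) (mu x : R) :
  0 < x ->
  whittaker_W ((1 + INR m) / 2) mu x
  = exp (- x / 2) * Rpower x ((1 + INR m) / 2)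
    * sol m (mu ^ 2 - (INR m / 2) ^ 2) (/ x).
Proof.
intros Hx; unfold whittaker_W.
set (a := mu - INR m / 2).
replace (1 / 2 + mu - (1 + INR m) / 2) with a by (unfold a; field).
replace (1 + 2 * mu) with (1 + INR m + 2 * a) by (unfold a; field).
rewrite tricomi_U_eq_sol by easy.
replace (a * (INR m + a)) with (mu ^ 2 - (INR m / 2) ^ 2) by (unfold a; field).
rewrite <- !Rmult_assoc, (Rmult_assoc (exp (- x / 2)) _ (Rpower x (- a))), <- Rpower_plus.
replace (mu + 1 / 2 + - a) with ((1 + INR m) / 2) by (unfold a; field).
easy.
Qed.

(** * Evaluation of the derivative *)

Lemma binomial_absorption (n i : nat) :
  (i <= n)%nat ->
  Binomial.C (S n) (S i) * INR (S i) = INR (S n) * Binomial.C n i.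
Proof.
intros Hi; unfold Binomial.C; change (S n - S i)%nat with (n - i)%nat.
rewrite !fact_simpl, !mult_INR.
assert (H1 := INR_fact_neq_0 n); assert (H2 := INR_fact_neq_0 i).
assert (H3 := INR_fact_neq_0 (n - i)); assert (H4 := not_0_INR (S i) ltac:(lia)).
field; easy.
Qed.

Lemma binomial_n_0 (n : nat) : Binomial.C n 0 = 1.
Proof.
unfold Binomial.C; rewrite Nat.sub_0_r; simpl fact.
assert (H := INR_fact_neq_0 n). simpl; field; easy.
Qed.

Lemma binomial_n_n (n : nat) : Binomial.C n n = 1.
Proof.
unfold Binomial.C; rewrite Nat.sub_diag; simpl (fact 0).
assert (H := INR_fact_neq_0 n). simpl; field; easy.
Qed.

(* [avg (S n) 1 y = int_0^oo e^(-u) (1 + u y)^n du]. *)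
Fixpoint fact_poly (n : nat) (y : R) : R :=
  match n with
  | O => 1
  | S n => 1 + INR (S n) * y * fact_poly n y
  end.

(** The equation for [l] is the one that [is_derive_avg] gives for [avg (S n)] of the constant 1. It
    makes [E] times the polynomial a primitive of the weight. *)
Lemma is_derive_fact_poly (n : nat) (y : R) :
  exists l, is_derive (fact_poly n) y l /\
    y ^ 2 * l + (1 - INR n * y) * fact_poly n y = 1.
Proof.
induction n as [|n [l [H1 H2]]].
- exists 0; split; [apply (is_derive_const (V := R_NormedModule))|]; simpl; ring.
- exists (INR (S n) * (fact_poly n y + y * l)); split.
  + change (fact_poly (S n)) with (fun y => 1 + INR (S n) * y * fact_poly n y).
    evar_last.
    * apply (is_derive_plus (V := R_NormedModule) (fun _ => 1));
        [apply is_derive_const|].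
      apply (is_derive_mult (fun y => INR (S n) * y) (fact_poly n) y (INR (S n)));
        [| exact H1 | intros; apply Rmult_comm].
      evar_last; [apply is_derive_scal, is_derive_id | apply Rmult_1_r].
    * change (0 + (INR (S n) * fact_poly n y + INR (S n) * y * l)
              = INR (S n) * (fact_poly n y + y * l)); ring.
  + change (fact_poly (S n) y) with (1 + INR (S n) * y * fact_poly n y).
    rewrite S_INR.
    replace (y ^ 2 * ((INR n + 1) * (fact_poly n y + y * l)))
      with ((INR n + 1) * (y ^ 2 * fact_poly n y + y * (y ^ 2 * l))) by ring.
    replace (y ^ 2 * l) with (1 - (1 - INR n * y) * fact_poly n y) by lra. ring.
Qed.

Lemma avg_1_fact_poly (n : nat) (y : R) :
  0 <= y -> avg (S n) (fun _ => 1) y = fact_poly n y.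
Proof.
intros Hy; destruct (Rle_dec y 0) as [Hy0|Hy0].
- rewrite avg_nonpos by easy. replace y with 0 by lra.
  destruct n; simpl; ring.
- rewrite avg_pos by lra.
  assert (HE := sq_weight_gt0 (S n) y ltac:(lra)).
  assert (HR : RInt (fun s => weight (S n) s * 1) 0 y
               = y ^ 2 * weight (S n) y * fact_poly n y).
  { apply (is_RInt_unique (V := R_CompleteNormedModule)); evar_last.
    - apply (is_RInt_derive (V := R_CompleteNormedModule)
        (fun s => s ^ 2 * weight (S n) s * fact_poly n s)).
      + intros s _; destruct (is_derive_fact_poly n s) as [l [H1 H2]]; evar_last.
        * apply (is_derive_mult (fun s => s ^ 2 * weight (S n) s) (fact_poly n));
            [apply is_derive_sq_weight | exact H1 | intros; apply Rmult_comm].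
        * transitivity (weight (S n) s
            * (s ^ 2 * l + (1 - INR n * s) * fact_poly n s)); [|now rewrite H2].
          rewrite S_INR; unfold plus, mult; simpl; ring.
      + intros s _; apply continuous_weight_mult, continuous_const.
    - unfold minus, plus, opp; simpl; ring. }
  rewrite HR; field; split; [|lra].
  apply Rgt_not_eq, weight_gt0; lra.
Qed.

Lemma fact_poly_sum (n : nat) (y : R) :
  fact_poly n y = sum_f_R0 (fun j => Binomial.C n j * INR (fact j) * y ^ j) n.
Proof.
induction n as [|n IH].
- simpl; rewrite binomial_n_0; ring.
- rewrite decomp_sum by lia. simpl Init.Nat.pred.
  change (fact_poly (S n) y) with (1 + INR (S n) * y * fact_poly n y).
  rewrite IH, scal_sum, binomial_n_0; f_equal; [simpl; ring|].
  apply sum_eq; intros i Hi.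
  rewrite fact_simpl, mult_INR, <- tech_pow_Rmult.
  replace (Binomial.C (S n) (S i) * (INR (S i) * INR (fact i)) * (y * y ^ i))
    with (Binomial.C (S n) (S i) * INR (S i) * INR (fact i) * (y * y ^ i)) by ring.
  rewrite binomial_absorption by easy; ring.
Qed.

Lemma is_derive_sum_pow (a : nat -> R) (n : nat) (y : R) :
  is_derive (fun y => sum_f_R0 (fun j => a j * y ^ S j) n) y
    (sum_f_R0 (fun j => a j * INR (S j) * y ^ j) n).
Proof.
assert (H : forall j, is_derive (fun y => a j * y ^ S j) y (a j * INR (S j) * y ^ j)).
{ intros j; evar_last; [apply is_derive_scal, is_derive_pow, is_derive_id|].
  change (Init.Nat.pred (S j)) with j. unfold one; simpl; ring. }
induction n as [|n IH]; [apply H|].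
apply (is_derive_plus (V := R_NormedModule)
  (fun y => sum_f_R0 (fun j => a j * y ^ S j) n)); [exact IH | apply H].
Qed.

(** Absorption [(n + 1) C(n, j) = (j + 1) C(n + 1, j + 1)]: the factor [j + 1] is the one produced
    by differentiating [y ^ S j]. *)
Lemma RInt_fact_poly (n : nat) (y : R) :
  INR (S n) * RInt (fact_poly n) 0 y
  = sum_f_R0 (fun j => Binomial.C (S n) (S j) * INR (fact j) * y ^ S j) n.
Proof.
assert (Hc : forall s, continuous (fact_poly n) s).
{ intros s; destruct (is_derive_fact_poly n s) as [l [H1 _]].
  apply (ex_derive_continuous (V := R_NormedModule)); now exists l. }
change (INR (S n) * RInt (fact_poly n) 0 y)
  with (scal (INR (S n)) (RInt (fact_poly n) 0 y)).
rewrite <- (RInt_scal (V := R_CompleteNormedModule)) by now apply ex_RInt_cont.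
apply (is_RInt_unique (V := R_CompleteNormedModule)); evar_last.
- apply (is_RInt_derive (V := R_CompleteNormedModule)
    (fun y => sum_f_R0 (fun j => Binomial.C (S n) (S j) * INR (fact j) * y ^ S j) n)).
  + intros s _; evar_last; [apply is_derive_sum_pow|].
    change (scal (INR (S n)) (fact_poly n s)) with (INR (S n) * fact_poly n s).
    rewrite fact_poly_sum, scal_sum; apply sum_eq; intros j Hj.
    replace (Binomial.C (S n) (S j) * INR (fact j) * INR (S j) * s ^ j)
      with (Binomial.C (S n) (S j) * INR (S j) * (INR (fact j) * s ^ j)) by ring.
    rewrite binomial_absorption by easy; ring.
  + intros s _; apply (continuous_scal_r (V := R_NormedModule) (INR (S n)) (fact_poly n)).
    apply Hc.
- rewrite (sum_eq (fun j => Binomial.C (S n) (S j) * INR (fact j) * 0 ^ S j) (fun _ => 0)).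
  + rewrite sum_cte; unfold minus, plus, opp; simpl Hierarchy.plus.
    rewrite Rmult_0_l; apply Rminus_0_r.
  + intros j _; rewrite pow_i by lia; ring.
Qed.

(* The upper incomplete gamma function of integer order is
   [Gamma(k + 1, z) = e^(-z) * inc_poly k z]. *)
Fixpoint inc_poly (k : nat) (z : R) : R :=
  match k with
  | O => 1
  | S k' => INR k * inc_poly k' z + z ^ k
  end.

Lemma inc_poly_0 (k : nat) : inc_poly k 0 = INR (fact k).
Proof.
induction k as [|k IH]; [easy|].
change (inc_poly (S k) 0) with (INR (S k) * inc_poly k 0 + 0 ^ S k).
rewrite IH, pow_i, fact_simpl, mult_INR by lia; ring.
Qed.

Lemma is_derive_inc_poly (k : nat) (z : R) :
  is_derive (inc_poly k) z (inc_poly k z - z ^ k).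
Proof.
induction k as [|k IH].
- evar_last; [apply (is_derive_const (V := R_NormedModule))|].
  unfold zero; simpl; ring.
- change (inc_poly (S k)) with (fun z => INR (S k) * inc_poly k z + z ^ S k).
  evar_last.
  + apply (is_derive_plus (V := R_NormedModule) (fun z => INR (S k) * inc_poly k z)).
    * apply is_derive_scal, IH.
    * apply is_derive_pow, is_derive_id.
  + change (Init.Nat.pred (S k)) with k.
    rewrite <- tech_pow_Rmult; unfold plus, one; simpl; ring.
Qed.

(** One primitive serves both gamma functions: from 0 to [z], of either sign, it gives
    [lower_gamma], and from 0 to infinity [Gamma]. *)
Lemma is_derive_exp_inc_poly (k : nat) (z : R) :
  is_derive (fun z => - (exp (- z) * inc_poly k z)) z (z ^ k * exp (- z)).
Proof.
evar_last.
- apply (is_derive_opp (V := R_NormedModule) (fun z => exp (- z) * inc_poly k z)).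
  apply (is_derive_mult (fun z => exp (- z)) (inc_poly k) z (- exp (- z)));
    [| apply is_derive_inc_poly | intros; apply Rmult_comm].
  auto_derive; [easy|ring].
- unfold opp, plus, mult; simpl; ring.
Qed.

Lemma continuous_pow_exp (k : nat) (z : R) :
  continuous (fun z => z ^ k * exp (- z)) z.
Proof.
apply (ex_derive_continuous (V := R_NormedModule)); auto_derive; easy.
Qed.

Lemma lower_gamma_S (k : nat) (z : R) :
  lower_gamma (S k) z = INR (fact k) - exp (- z) * inc_poly k z.
Proof.
unfold lower_gamma; replace (S k - 1)%nat with k by lia.
apply (is_RInt_unique (V := R_CompleteNormedModule)); evar_last.
- apply (is_RInt_derive (V := R_CompleteNormedModule)
    (fun z => - (exp (- z) * inc_poly k z))); intros t _.
  + apply is_derive_exp_inc_poly.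
  + apply continuous_pow_exp.
- rewrite inc_poly_0, Ropp_0, exp_0; unfold minus, plus, opp; simpl; ring.
Qed.

Lemma is_lim_pow_exp (k : nat) :
  is_lim (fun z => z ^ k * exp (- z)) p_infty 0.
Proof.
apply is_lim_le_le_loc with (fun _ => 0) (fun z => INR (fact (S k)) * / z).
- exists 0; intros z Hz; split.
  + apply Rmult_le_pos; [now apply pow_le, Rlt_le | apply Rlt_le, exp_pos].
  + assert (H := pow_div_fact_le_exp (S k) z (Rlt_le _ _ Hz)).
    assert (HF := INR_fact_lt_0 (S k)). assert (He := exp_pos z).
    rewrite exp_Ropp.
    apply Rmult_le_reg_r with (exp z * z); [now apply Rmult_lt_0_compat|].
    replace (z ^ k * / exp z * (exp z * z)) with (z ^ S k) by (simpl; field; lra).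
    replace (INR (fact (S k)) * / z * (exp z * z)) with (INR (fact (S k)) * exp z)
      by (field; lra).
    apply (Rle_div_l _ _ (INR (fact (S k)))) in H; [|easy]. lra.
- apply is_lim_const.
- replace (Finite 0) with (Rbar_mult (INR (fact (S k))) 0)
    by (simpl; f_equal; ring).
  apply is_lim_scal_l, (is_lim_inv (fun z => z) p_infty p_infty);
    [apply is_lim_id | easy].
Qed.

Lemma is_lim_exp_inc_poly (k : nat) :
  is_lim (fun z => - (exp (- z) * inc_poly k z)) p_infty 0.
Proof.
induction k as [|k IH].
- apply is_lim_ext with (fun z => -1 * (z ^ 0 * exp (- z))).
  + intros z; simpl; ring.
  + replace (Finite 0) with (Rbar_mult (-1) 0) by (simpl; f_equal; ring).
    apply is_lim_scal_l, is_lim_pow_exp.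
- apply is_lim_ext with (fun z => INR (S k) * - (exp (- z) * inc_poly k z)
                                  - z ^ S k * exp (- z)).
  + intros z. change (inc_poly (S k) z) with (INR (S k) * inc_poly k z + z ^ S k). ring.
  + replace (Finite 0) with (Finite (INR (S k) * 0 - 0)) by (f_equal; ring).
    apply is_lim_minus'; [|apply is_lim_pow_exp].
    now apply (is_lim_scal_l _ _ _ (Finite 0)).
Qed.

Lemma Gamma_S (k : nat) : Gamma (INR (S k)) = INR (fact k).
Proof.
unfold Gamma.
apply (is_RInt_gen_unique (V := R_CompleteNormedModule)).
set (F := fun z => - (exp (- z) * inc_poly k z)).
assert (HD : forall t, Derive F t = t ^ k * exp (- t)).
{ intros t; apply is_derive_unique, is_derive_exp_inc_poly. }
assert (H0 : is_RInt_gen (Derive F) (at_right 0) (Rbar_locally p_infty)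
               (0 - - INR (fact k))).
{ apply is_RInt_gen_Derive.
  - apply filter_forall; intros ab t _; eexists; apply is_derive_exp_inc_poly.
  - apply filter_forall; intros ab t _.
    apply continuous_ext with (fun t => t ^ k * exp (- t)).
    + intros; symmetry; apply HD.
    + apply continuous_pow_exp.
  - eapply filterlim_filter_le_1;
      [apply (filter_le_within (F := locally 0))|].
    replace (- INR (fact k)) with (F 0)
      by (unfold F; rewrite inc_poly_0, Ropp_0, exp_0; ring).
    apply (ex_derive_continuous (V := R_NormedModule) F).
    eexists; apply is_derive_exp_inc_poly.
  - apply is_lim_exp_inc_poly. }
replace (0 - - INR (fact k)) with (INR (fact k)) in H0 by ring.
revert H0; apply is_RInt_gen_ext.
(* [Rpower] agrees with the natural power at positive arguments, and both filters keep the endpoints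
   positive. *)
apply Filter_prod with (fun x => 0 < x) (fun y => 0 < y).
- now exists (mkposreal 1 Rlt_0_1).
- now exists 0.
- intros x y Hx Hy t Ht; simpl in Ht.
  assert (Ht0 : 0 < t).
  { apply Rlt_trans with (2 := proj1 Ht); now apply Rmin_pos. }
  rewrite HD, S_INR, <- Rpower_pow by easy.
  now replace (INR k + 1 - 1) with (INR k) by ring.
Qed.

(** * Binomial identities and the gamma sum *)

(** Inserting the recurrence, the signs [(-1)^k] add up to [(1 - 1)^(m+1) = 0], and absorption turns
    the rest into [(m + 1) y] times the preceding sum. *)
Lemma binomial_sum_recurrence (y : R) (q : nat -> R) (m : nat) :
  q 0%nat = 1 ->
  (forall k, q (S k) = (-1) ^ S k + INR (S k) * y * q k) ->
  sum_f_R0 (fun k => Binomial.C m k * q k) m = INR (fact m) * y ^ m.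
Proof.
intros H0 HS; induction m as [|m IH].
- simpl; rewrite binomial_n_0, H0; ring.
- rewrite decomp_sum by lia; simpl Init.Nat.pred.
  assert (HB := binomial (-1) 1 (S m)).
  replace (-1 + 1) with 0 in HB by ring.
  rewrite pow_i, decomp_sum in HB by lia; simpl Init.Nat.pred in HB.
  rewrite (sum_eq _ (fun i => Binomial.C (S m) (S i) * (-1) ^ S i * 1 ^ (S m - S i)
      + Binomial.C m i * q i * (INR (S m) * y))).
  + rewrite plus_sum, <- scal_sum, IH, H0, fact_simpl, mult_INR.
    rewrite pow1, pow_O in HB. rewrite <- tech_pow_Rmult. lra.
  + intros i Hi; rewrite HS, pow1.
    replace (Binomial.C m i * q i * (INR (S m) * y))
      with (INR (S m) * Binomial.C m i * (q i * y)) by ring.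
    rewrite <- binomial_absorption by easy; ring.
Qed.

(** Pascal's rule splits the sum for [n + 1] into the sum for [n] and an unshifted sum, whose value
    is the new term [(n + 1)! y^(n+1)]. *)
Lemma binomial_sum_recurrence_shift (y : R) (q : nat -> R) (n : nat) :
  q 0%nat = 1 ->
  (forall k, q (S k) = (-1) ^ S k + INR (S k) * y * q k) ->
  sum_f_R0 (fun j => Binomial.C (S n) (S j) * q j) n
  = sum_f_R0 (fun j => INR (fact j) * y ^ j) n.
Proof.
intros H0 HS; induction n as [|n IH].
- simpl; rewrite binomial_n_n, H0; ring.
- rewrite (tech5 (fun j => INR (fact j) * y ^ j)), <- IH.
  rewrite <- (binomial_sum_recurrence y q (S n) H0 HS), !tech5, !binomial_n_n.
  rewrite <- Rplus_assoc, <- plus_sum; f_equal.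
  apply sum_eq; intros i Hi; rewrite <- pascal by lia; ring.
Qed.

(** Both gamma functions are expanded in factorials and [inc_poly]. The terms carrying [exp x]
    cancel by the shifted identity, with [q k = x^(-k) inc_poly k (-x)], and the constants [j!] of
    [lower_gamma] remain. *)
Lemma gamma_sum_eq (n : nat) (x : R) :
  0 < x ->
  sum_n_m (fun k => / x ^ k * (exp x * Gamma (INR k)
                               + Binomial.C (S n) k * lower_gamma k (- x))) 1 (S n)
  = sum_f_R0 (fun j => Binomial.C (S n) (S j) * INR (fact j) * (/ x) ^ S j) n.
Proof.
intros Hx; rewrite <- sum_n_m_S.
change (sum_n_m ?F 0 n) with (sum_n F n); rewrite sum_n_Reals.
set (y := / x). set (q := fun k => y ^ k * inc_poly k (- x)).
assert (Hq : forall k, q (S k) = (-1) ^ S k + INR (S k) * y * q k).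
{ intros k; unfold q.
  change (inc_poly (S k) (- x)) with (INR (S k) * inc_poly k (- x) + (- x) ^ S k).
  replace (-1) with (y * - x) by (unfold y; field; lra).
  rewrite Rpow_mult_distr, <- !(tech_pow_Rmult y). ring. }
assert (E := binomial_sum_recurrence_shift y q n ltac:(unfold q; simpl; ring) Hq).
rewrite (sum_eq _ (fun j => Binomial.C (S n) (S j) * INR (fact j) * y ^ S j
  + (INR (fact j) * y ^ j * (exp x * y)
     + Binomial.C (S n) (S j) * q j * - (exp x * y)))).
- rewrite !plus_sum, <- !scal_sum, E; apply Rminus_diag_uniq; ring.
- intros j _; rewrite Gamma_S, lower_gamma_S, Ropp_involutive, <- pow_inv.
  fold y; unfold q; rewrite <- tech_pow_Rmult; ring.
Qed.

Lemma iter_avg_1_gamma_sum (m : nat) (x : R) :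
  0 < x ->
  INR m * iter_avg m 1 (/ x)
  = sum_n_m (fun k => / x ^ k * (exp x * Gamma (INR k)
                                 + Binomial.C m k * lower_gamma k (- x))) 1 m.
Proof.
intros Hx; destruct m as [|n].
(* For [m = 0] the sum is empty and the factor [INR 0] annihilates the left side. *)
- rewrite sum_n_m_zero by lia; unfold zero; simpl; ring.
- assert (Hy := Rinv_0_lt_compat x Hx).
  rewrite gamma_sum_eq, <- RInt_fact_poly by easy; f_equal.
  change (iter_avg (S n) 1 (/ x))
    with (RInt (avg (S n) (fun _ => 1)) 0 (Rmax 0 (/ x))).
  rewrite Rmax_right by lra; apply RInt_ext; intros s.
  rewrite Rmin_left, Rmax_right by lra; intros Hs; apply avg_1_fact_poly; lra.
Qed.

Theorem theorem28 (m : nat) (x : R) (s : R) (hx : 0 < x)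
  (hs : s = 1 \/ s = - 1) :
  is_derive (fun mu : R => whittaker_W ((1 + INR m) / 2) mu x)
    (s * (INR m / 2))
    (s * (exp (- x / 2) * Rpower x ((1 + INR m) / 2) *
          sum_n_m (fun k : nat =>
             / x ^ k * (exp x * Gamma (INR k)
                        + Binomial.C m k * lower_gamma k (- x))) 1 m)).
Proof.
rewrite <- iter_avg_1_gamma_sum by easy.
set (c := fun mu => mu ^ 2 - (INR m / 2) ^ 2).
apply is_derive_ext with (fun mu =>
  exp (- x / 2) * Rpower x ((1 + INR m) / 2) * sol m (c mu) (/ x)).
{ intros mu; symmetry; now apply whittaker_W_eq_sol. }
(* The point is sent to the centre [c = 0] of the series, and the chain rule contributes
   [2 * mu = s * INR m], the source of the sign and of the factor [m]. *)
assert (Hc0 : c (s * (INR m / 2)) = 0) by (unfold c; destruct hs; subst s; ring).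
evar_last.
- apply is_derive_scal, (is_derive_comp (fun c => sol m c (/ x)) c).
  + rewrite Hc0; apply is_derive_sol_parameter.
  + unfold c; auto_derive; easy.
- unfold scal; simpl; unfold mult; simpl; field.
Qed.
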